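(* Let $\mathbb{F}$ be a finite field and let $$\mathbf{G}=\begin{pmatrix} 1 & 0 & 0 & 0 & a_1 & \underline{a}_1 \\ 0 & 1 & 0 & 0 & a_2 & \underline{a}_2 \\ 0 & 0 & 1 & 0 & b_1 & \underline{b}_1 \\ 0 & 0 & 0 & 1 & b_2 & \underline{b}_2 \end{pmatrix}$$ be the generator matrix over $\mathbb{F}$ of a systematic $(6,4)$ MDS code (i.e. every four columns of $\mathbf{G}$ are linearly independent). Define the $4\times 2$ matrices $$\mathbf{Q}_1=\begin{pmatrix} 1 & 0 \\ 0 & 1 \\ 0 & 0 \\ 0 & 0 \end{pmatrix},\ \mathbf{Q}_2=\begin{pmatrix} 0 & 0 \\ 0 & 0 \\ 1 & 0 \\ 0 & 1 \end{pmatrix},\ \mathbf{Q}_3=\begin{pmatrix} a_1 & \underline{a}_1 \\ a_2 & \underline{a}_2 \\ b_1 & \underline{b}_1 \\ b_2 & \underline{b}_2 \end{pmatrix},$$ $$\mathbf{Q}_4=\begin{pmatrix} a_1 & 0 \\ a_2 & 0 \\ 0 & b_1 \\ 0 & b_2 \end{pmatrix},\ \mathbf{Q}_5=\begin{pmatrix} \underline{a}_1 & 0 \\ \underline{a}_2 & 0 \\ 0 & \underline{b}_1 \\ 0 & \underline{b}_2 \end{pmatrix},\ \mathbf{Q}_6=\begin{pmatrix} a_1+\underline{a}_1 & 0 \\ a_2+\underline{a}_2 & 0 \\ 0 & b_1+\underline{b}_1 \\ 0 & b_2+\underline{b}_2 \end{pmatrix}.$$ Then the code in which node $i$ stores the two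 packets with coding vectors the columns of $\mathbf{Q}_i$ is an exact-repair locally repairable regenerating code for $(n,k,d,r)=(6,3,2,1)$ under the modified family helper selection scheme, with file size $\mathcal{M}=4$, storage $\alpha=2$ and repair bandwidth $\beta=1$ per helper. That is: (1) (Reconstruction) for every three distinct nodes $i,j,l\in\{1,\dots,6\}$, the $4\times 6$ matrix $[\mathbf{Q}_i,\mathbf{Q}_j,\mathbf{Q}_l]$ has rank $4$; (2) (Exact repair) for every node $f\in\{1,\dots,6\}$ and every two distinct nodes $x_1,x_2$ in the family not containing $f$, where the families are $\{1,2,3\}$ and $\{4,5,6\}$, there exist $\mathbf{b}_1,\mathbf{b}_2\in\mathbb{F}^{2}$ (column vectors) and $\mathbf{Z}\in\mathbb{F}^{2\times 2}$ such that $\mathbf{Q}_f=[\mathbf{Q}_{x_1}\mathbf{b}_1,\ \mathbf{Q}_{x_2}\mathbf{b}_2]\,\mathbf{Z}$.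
   Context: In this code the file consists of $\mathcal{M}=4$ packets, the rows of a matrix $\mathbf{X}$ over $\mathbb{F}$ with $4$ rows; node $i$ stores the $\alpha=2$ packets $\mathbf{X}^T\mathbf{Q}_i$. The parameters $(n,k,d,r)$ mean: $n$ nodes; any $k$ nodes must be able to reconstruct the file; a failed node is repaired from $d$ helpers, each sending $\beta=1$ packet (a linear combination of its stored packets); the repair must be possible even if any $r$ of the nodes are unavailable. In the modified family helper selection scheme for $(6,3,2,1)$, the nodes are split into the two families $\{1,2,3\}$ and $\{4,5,6\}$ of size $n-d-r=3$, and a failed node is repaired by any $d=2$ available nodes among the $d+r=3$ nodes of the other family. Exact repair means that the newcomer recovers exactly the packets of the failed node. Underlined symbols such as $\underline{a}_1$ are simply other field elements, unrelated in notation to $a_1$. *)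

(* Defs.v *)
From HB Require Import structures.
From mathcomp Require Import all_boot all_order all_algebra.

Set Implicit Arguments.
Unset Strict Implicit.
Unset Printing Implicit Defensive.

Import GRing.Theory.
Local Open Scope ring_scope.

(* Entries missing from the list are read as 0. *)
Definition mx_of_rows (F : finFieldType) (m n : nat) (s : seq (seq F)) :
    'M[F]_(m, n) :=
  \matrix_(i < m, j < n) nth 0 (nth [::] s i) j.

(* G generates an (n, k) MDS code: every k columns of G (at pairwise distinct
   positions) are linearly independent. *)
Definition MDS_generator (F : finFieldType) (k n : nat) (G : 'M[F]_(k, n)) :=
  forall s : 'I_k -> 'I_n, injective s -> row_free (colsub s G)^T.

Definition genG (F : finFieldType) (a1 a2 b1 b2 ua1 ua2 ub1 ub2 : F) :
    'M[F]_(4, 6) :=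
  mx_of_rows 4 6
    [:: [:: 1; 0; 0; 0; a1; ua1];
        [:: 0; 1; 0; 0; a2; ua2];
        [:: 0; 0; 1; 0; b1; ub1];
        [:: 0; 0; 0; 1; b2; ub2] ].

(* Nodes are numbered from 0: the element i : 'I_6 is node i + 1, so that
   nodeQ .. i is the matrix Q_(i + 1). *)
Definition nodeQ (F : finFieldType) (a1 a2 b1 b2 ua1 ua2 ub1 ub2 : F)
    (i : 'I_6) : 'M[F]_(4, 2) :=
  nth 0
    [:: mx_of_rows 4 2 [:: [:: 1; 0]; [:: 0; 1]; [:: 0; 0]; [:: 0; 0] ];
        mx_of_rows 4 2 [:: [:: 0; 0]; [:: 0; 0]; [:: 1; 0]; [:: 0; 1] ];
        mx_of_rows 4 2 [:: [:: a1; ua1]; [:: a2; ua2];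
                           [:: b1; ub1]; [:: b2; ub2] ];
        mx_of_rows 4 2 [:: [:: a1; 0]; [:: a2; 0]; [:: 0; b1]; [:: 0; b2] ];
        mx_of_rows 4 2 [:: [:: ua1; 0]; [:: ua2; 0];
                           [:: 0; ub1]; [:: 0; ub2] ];
        mx_of_rows 4 2 [:: [:: a1 + ua1; 0]; [:: a2 + ua2; 0];
                           [:: 0; b1 + ub1]; [:: 0; b2 + ub2] ] ]
    i.

(* Nodes {1, 2, 3} and {4, 5, 6}. *)
Definition family1 : {set 'I_6} := [set i : 'I_6 | (i < 3)%N].
Definition family2 : {set 'I_6} := [set i : 'I_6 | (3 <= i)%N].

Definition helper_family (f : 'I_6) : {set 'I_6} :=
  if f \in family1 then family2 else family1.

Definition reconstruction (F : finFieldType) (Q : 'I_6 -> 'M[F]_(4, 2)) :=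
  forall i j l : 'I_6, i != j -> i != l -> j != l ->
    \rank (row_mx (row_mx (Q i) (Q j)) (Q l)) = 4%N.

(* Each of the two helpers x sends the single packet with coding vector
   Q x *m b, and Z is the decoding matrix of the newcomer. *)
Definition exact_repair (F : finFieldType) (Q : 'I_6 -> 'M[F]_(4, 2)) :=
  forall f x1 x2 : 'I_6,
    x1 \in helper_family f -> x2 \in helper_family f -> x1 != x2 ->
    exists (b1 b2 : 'cV[F]_2) (Z : 'M[F]_2),
      Q f = row_mx (Q x1 *m b1) (Q x2 *m b2) *m Z.

(* Main.v *)
Require Import Defs.
From mathcomp Require Import all_boot all_order all_algebra.

Set Implicit Arguments.
Unset Strict Implicit.
Unset Printing Implicit Defensive.

Import GRing.Theory.

Local Open Scope ring_scope.

(** Write the nonsystematic part of G as two square blocks A = [a, ua] and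
    B = [b, ub].  Independence of the columns 3, 4, 5, 6 (resp. 1, 2, 5, 6) of
    G means that A (resp. B) is invertible.  Nodes 4, 5, 6 store the
    block-diagonal matrices diag(A w, B w) with w = e0, e1, e0 + e1, any two of
    which span the plane.  Two nodes of the same family already determine the
    file, and three nodes always contain two of the same family.  For a repair,
    the three possible helpers send packets p0, p1 and p2 = p0 + p1, so that any
    two of them suffice. *)

(** With [U] and [V] the rows of [Z], [M] is [p 0 *m U + p 1 *m V]; whichever of [p 0], [p 1] is
    missing is replaced by its difference from [p 2]. Both directions of repair decode this way. *)
Lemma factor_through_two (R : pzRingType) (m n : nat) (p : nat -> 'cV[R]_m)
    (M : 'M[R]_(m, n)) (Z : 'M[R]_(2, n)) :
  p 2%N = p 0%N + p 1%N -> M = row_mx (p 0%N) (p 1%N) *m Z ->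
  forall i j, (i < 3)%N -> (j < 3)%N -> i != j ->
  exists Z' : 'M[R]_(2, n), M = row_mx (p i) (p j) *m Z'.
Proof.
move=> p2; rewrite -[Z](@vsubmxK _ 1 1) mul_row_col.
move: (usubmx _) (dsubmx _) => /= {Z} U V defM.
suff combine i j (X Y : 'rV_n) : M = p i *m X + p j *m Y ->
    exists Z' : 'M[R]_(2, n), M = row_mx (p i) (p j) *m Z'.
  case=> [|[|[|//]]] [|[|[|//]]] _ _ // _.
  - exact: (combine _ _ U V).
  - by apply: (combine _ _ (U - V) V); rewrite p2 mulmxDl mulmxBr addrA subrK.
  - by apply: (combine _ _ V U); rewrite addrC.
  - by apply: (combine _ _ (V - U) U); rewrite p2 mulmxDl mulmxBr addrCA subrK.
  - apply: (combine _ _ V (U - V)).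
    by rewrite p2 mulmxDl mulmxBr [RHS]addrC addrA subrK.
  apply: (combine _ _ U (V - U)).
  by rewrite p2 mulmxDl mulmxBr [RHS]addrC addrCA subrK.
by move=> ->; exists (col_mx X Y : 'M_(1 + 1, n)); rewrite mul_row_col.
Qed.

Definition cols2 (F : pzRingType) (x1 y1 x2 y2 : F) : 'M[F]_2 :=
  \matrix_(i < 2, j < 2) nth 0 (nth [::] [:: [:: x1; y1]; [:: x2; y2]] i) j.

Definition mixer (F : pzRingType) (k : nat) : 'cV[F]_2 :=
  nth 0 [:: delta_mx 0 0; delta_mx 1 0; delta_mx 0 0 + delta_mx 1 0] k.

Lemma mixer_span (F : pzRingType) (i j : nat) :
  (i < 3)%N -> (j < 3)%N -> i != j ->
  exists Z : 'M[F]_2, 1%:M = row_mx (mixer F i) (mixer F j) *m Z.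
Proof.
apply: (@factor_through_two _ _ _ (@mixer F) _ 1%:M) => //.
rewrite mulmx1; apply/matrixP => k l; rewrite !mxE.
by case: splitP => l' /=; rewrite ord1 mxE eqxx andbT => ll'; congr (_ == _)%:R;
  apply/val_inj.
Qed.

Lemma mixer_faithful (F : pzRingType) (m i j : nat) (M : 'M[F]_(m, 2)) :
  (i < 3)%N -> (j < 3)%N -> i != j ->
  M *m mixer F i = 0 -> M *m mixer F j = 0 -> M = 0.
Proof.
move=> lti ltj neq_ij Mi Mj; have [Z oneE] := mixer_span F lti ltj neq_ij.
by rewrite -[M]mulmx1 oneE mulmxA mul_mx_row Mi Mj row_mx0 mul0mx.
Qed.

(** The index is a bare [nat] so that [k.+3] runs over the second family, and the dimensions are
    kept as sums so that the block lemmas apply. *)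
Definition blockQ (F : pzRingType) (A B : 'M[F]_2) (i : nat) :
    'M[F]_(2 + 2, 2) :=
  match i with
  | 0 => col_mx 1%:M 0
  | 1 => col_mx 0 1%:M
  | 2 => col_mx A B
  | k.+3 => block_mx (A *m mixer F k) 0 0 (B *m mixer F k) : 'M_(2 + 2, 1 + 1)
  end.

(** Split [r] into halves [x], [y]. In the first family a systematic node kills one half, and node 3
    then kills the other through [A] or [B]. In the second family [x *m A] and [y *m B] vanish on
    two independent mixers, hence vanish. *)
Lemma blockQ_pair (F : pzRingType) (A B : 'M[F]_2) (i j : nat)
    (r : 'rV[F]_(2 + 2)) :
  (forall x : 'rV_2, x *m A = 0 -> x = 0) ->
  (forall y : 'rV_2, y *m B = 0 -> y = 0) ->
  (i < 6)%N -> (j < 6)%N -> i != j -> (i < 3)%N = (j < 3)%N ->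
  r *m blockQ A B i = 0 -> r *m blockQ A B j = 0 -> r = 0.
Proof.
rewrite -[r]hsubmxK; move: (lsubmx r) (rsubmx r) => x y injA injB.
case: i => [|[|[|i]]]; case: j => [|[|[|j]]] //=;
  rewrite ?(mul_row_block (p1 := 1) (p2 := 1)) ?mul_row_col
    ?(mulmx0, mulmx1, addr0, add0r).
- by move=> _ _ _ _ -> ->; rewrite row_mx0.
- move=> _ _ _ _ ->; rewrite mul0mx add0r => /injB ->.
  by rewrite row_mx0.
- by move=> _ _ _ _ -> ->; rewrite row_mx0.
- move=> _ _ _ _ ->; rewrite mul0mx addr0 => /injA ->.
  by rewrite row_mx0.
- move=> _ _ _ _ /[swap] ->; rewrite mul0mx add0r => /injB ->.
  by rewrite row_mx0.
- move=> _ _ _ _ /[swap] ->; rewrite mul0mx addr0 => /injA ->.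
  by rewrite row_mx0.
rewrite !eqSS !ltnS !mulmxA => lti ltj neq_ij _.
have split0 (u v : 'M_1) : row_mx u v = 0 :> 'M_(1, 1 + 1) -> u = 0 /\ v = 0.
  by move/eqP; rewrite row_mx_eq0 => /andP[/eqP-> /eqP->].
move=> /split0[xi yi] /split0[xj yj].
have x0 := injA _ (mixer_faithful lti ltj neq_ij xi xj).
have y0 := injB _ (mixer_faithful lti ltj neq_ij yi yj).
by rewrite x0 y0 row_mx0.
Qed.

(** All helpers can use one vector [b]: helper [k] then sends [M *m mixer F k] for a common [M],
    which any two such packets determine. *)
Lemma repair_family1 (F : pzRingType) (A B A' B' : 'M[F]_2) (f i j : nat) :
  A *m A' = 1%:M -> B *m B' = 1%:M ->
  (f < 3)%N -> (i < 3)%N -> (j < 3)%N -> i != j ->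
  exists (b1 b2 : 'cV[F]_2) (Z : 'M[F]_2),
    blockQ A B f =
      row_mx (blockQ A B i.+3 *m b1) (blockQ A B j.+3 *m b2) *m Z.
Proof.
move=> AK BK ltf lti ltj neq_ij.
have [M [b [Z [-> sends]]]] : exists (M : 'M[F]_(2 + 2, 2)) b (Z : 'M[F]_2),
    blockQ A B f = M *m Z /\
    forall k, blockQ A B k.+3 *m b = M *m mixer F k.
  (* Nodes 1, 2, 3 use [b] = (1,0), (0,1), (1,1); the zero entry erases the [B] or the [A] half, and
     [A'] or [B'] undoes the remaining block. *)
  case: f ltf => [|[|[|//]]] _ /=.
  - exists (col_mx A 0), (col_mx 1%:M 0 : 'cV_(1 + 1)), A'.
    split=> [|k]; rewrite ?(mul_block_col (n1 := 1) (n2 := 1)) mul_col_mx.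
      by rewrite AK mul0mx.
    by rewrite !mul0mx !mulmx0 mulmx1 !addr0.
  - exists (col_mx 0 B), (col_mx 0 1%:M : 'cV_(1 + 1)), B'.
    split=> [|k]; rewrite ?(mul_block_col (n1 := 1) (n2 := 1)) mul_col_mx.
      by rewrite BK mul0mx.
    by rewrite !mul0mx !mulmx0 mulmx1 !add0r.
  exists (col_mx A B), (col_mx 1%:M 1%:M : 'cV_(1 + 1)), 1%:M.
  split=> [|k]; first by rewrite mulmx1.
  rewrite (mul_block_col (n1 := 1) (n2 := 1)) mul_col_mx.
  by rewrite !mul0mx !mulmx1 addr0 add0r.
have [Z' oneE] := mixer_span F lti ltj neq_ij.
exists b, b, (Z' *m Z).
by rewrite !sends -mul_mx_row mulmxA -(mulmxA M) -oneE mulmx1.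
Qed.

(** Nodes 1 and 2 send the two columns of the lost node, (u,0) and (0,v); node 3, combining with the
    mixer of the lost node, sends their sum (u,v). *)
Lemma repair_family2 (F : pzRingType) (A B : 'M[F]_2) (k i j : nat) :
  (i < 3)%N -> (j < 3)%N -> i != j ->
  exists (b1 b2 : 'cV[F]_2) (Z : 'M[F]_2),
    blockQ A B k.+3 =
      row_mx (blockQ A B i *m b1) (blockQ A B j *m b2) *m Z.
Proof.
move=> lti ltj neq_ij; set u := A *m mixer F k; set v := B *m mixer F k.
pose b := nth 0 [:: u; v; mixer F k].
suff [Z ->] : exists Z : 'M_2,
    blockQ A B k.+3 = row_mx (blockQ A B i *m b i) (blockQ A B j *m b j) *m Z.
  by exists (b i), (b j), Z.
apply: (@factor_through_two _ _ _ (fun i => blockQ A B i *m b i) _ 1%:M) => //=;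
  rewrite !mul_col_mx !mul1mx !mul0mx.
  by rewrite add_col_mx addr0 add0r.
by rewrite mulmx1 (block_mxEh (n1 := 1) (n2 := 1)).
Qed.

Lemma nodeQ_block (F : finFieldType) (a1 a2 b1 b2 ua1 ua2 ub1 ub2 : F)
    (i : 'I_6) :
  nodeQ a1 a2 b1 b2 ua1 ua2 ub1 ub2 i =
  blockQ (cols2 a1 ua1 a2 ua2) (cols2 b1 ub1 b2 ub2) i.
Proof.
case: i => [[|[|[|[|[|[|//]]]]]] lti]; rewrite /nodeQ /= /mixer /=;
  rewrite ?mulmxDr -?colE; apply/matrixP => r c; rewrite [LHS]mxE.
1-3: by rewrite mxE; case: (@splitP 2 2 r) => r' /= ->; rewrite !mxE;
  case: r' c => [[|[|//]] ?] [[|[|//]] ?].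
all: rewrite mxE; case: (@splitP 2 2 r) => r' /= ->; rewrite mxE;
  case: (@splitP 1 1 c) => c' /= ->; rewrite !mxE ord1 /=;
  by case: r' => [[|[|//]] ?].
Qed.

Lemma genG_block (F : finFieldType) (a1 a2 b1 b2 ua1 ua2 ub1 ub2 : F) :
  genG a1 a2 b1 b2 ua1 ua2 ub1 ub2 =
  row_mx 1%:M (col_mx (cols2 a1 ua1 a2 ua2) (cols2 b1 ub1 b2 ub2))
    :> 'M_(4, 4 + 2).
Proof.
apply/matrixP => i j; rewrite !mxE.
case: splitP => j' -> /=; rewrite !mxE /=.
  by case: i => [[|[|[|[|//]]]] ?]; case: j' => [[|[|[|[|//]]]] ?].
case: (@splitP 2 2 i) => i' -> /=; rewrite !mxE /=;
  by case: i' => [[|[|//]] ?]; case: j' => [[|[|//]] ?].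
Qed.

Lemma MDS_mulmx_inj (F : finFieldType) (k n : nat) (G : 'M[F]_(k, n))
    (s : 'I_k -> 'I_n) (r : 'rV[F]_k) :
  MDS_generator G -> injective s -> (forall i, (r *m G) 0 (s i) = 0) -> r = 0.
Proof.
move=> mdsG inj_s rG0; have := mdsG s inj_s.
(* The chosen columns form a square matrix, so their independence gives that of its rows. *)
rewrite row_free_unit unitmx_tr -row_free_unit => /row_free_inj.
apply; rewrite mul0mx mulmx_colsub; apply/rowP => i.
by rewrite mxE rG0 mxE.
Qed.

Lemma MDS_kernel_upper (F : finFieldType) (A B : 'M[F]_2) (x : 'rV[F]_2) :
  MDS_generator (row_mx 1%:M (col_mx A B) : 'M_(2 + 2, 4 + 2)) ->
  x *m A = 0 -> x = 0.
Proof.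
(* The codeword of (x,0) is (x, 0, x A), which vanishes on the last four columns. *)
move=> mdsG xA0; pose s (k : 'I_(2 + 2)) : 'I_(4 + 2) := inord k.+2.
have sE k : s k = k.+2 :> nat.
  by rewrite inordK //; case: k => [[|[|[|[|//]]]] ?].
have inj_s : injective s.
  by move=> k l /(congr1 (@nat_of_ord _)); rewrite !sE => -[/val_inj].
suff : row_mx x (0 : 'rV_2) = 0 by move/eqP; rewrite row_mx_eq0 => /andP[/eqP].
apply: (MDS_mulmx_inj mdsG inj_s) => k.
rewrite mul_mx_row mulmx1 mul_row_col xA0 mul0mx addr0 mxE.
case: splitP => l; last by rewrite mxE.
rewrite mxE; case: splitP => [l' -> | l' _ _]; last by rewrite mxE.
by rewrite sE => kl; have := ltn_ord l'; rewrite -kl.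
Qed.

Lemma MDS_kernel_lower (F : finFieldType) (A B : 'M[F]_2) (y : 'rV[F]_2) :
  MDS_generator (row_mx 1%:M (col_mx A B) : 'M_(2 + 2, 4 + 2)) ->
  y *m B = 0 -> y = 0.
Proof.
move=> mdsG yB0.
(* The codeword of (0,y) is (0, y, y B); [s] skips the two columns holding [y]. *)
pose s (k : 'I_(2 + 2)) : 'I_(4 + 2) := inord (if (k < 2)%N then k : nat else k.+2).
have sE k : s k = (if (k < 2)%N then k : nat else k.+2) :> nat.
  by rewrite inordK //; case: k => [[|[|[|[|//]]]] ?].
have inj_s : injective s.
  move=> k l /(congr1 (@nat_of_ord _)); rewrite !sE => kl; apply/val_inj; move: kl.
  by case: k l => [[|[|[|[|//]]]] ?] [[|[|[|[|//]]]] ?].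
suff : row_mx (0 : 'rV_2) y = 0 by move/eqP; rewrite row_mx_eq0 => /andP[_ /eqP].
apply: (MDS_mulmx_inj mdsG inj_s) => k.
rewrite mul_mx_row mulmx1 mul_row_col yB0 mul0mx addr0 mxE.
case: splitP => l; last by rewrite mxE.
rewrite mxE; case: splitP => [l' _ _ | l' ->]; first by rewrite mxE.
rewrite sE; case: ltnP => [+ kl | + [kl]]; first by rewrite kl.
by rewrite kl leqNgt ltn_ord.
Qed.

Theorem mainTheorem2 (F : finFieldType) (a1 a2 b1 b2 ua1 ua2 ub1 ub2 : F)
    (hMDS : MDS_generator (genG a1 a2 b1 b2 ua1 ua2 ub1 ub2)) :
  reconstruction (nodeQ a1 a2 b1 b2 ua1 ua2 ub1 ub2) /\
  exact_repair (nodeQ a1 a2 b1 b2 ua1 ua2 ub1 ub2).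
Proof.
rewrite genG_block in hMDS.
set A := cols2 a1 ua1 a2 ua2 in hMDS; set B := cols2 b1 ub1 b2 ub2 in hMDS.
have injA x := @MDS_kernel_upper _ _ _ x hMDS.
have injB y := @MDS_kernel_lower _ _ _ y hMDS.
split=> [i j l neq_ij neq_il neq_jl | f x1 x2].
  (* Rank 4 is full row rank, so it suffices that the left kernel is trivial. *)
  rewrite !nodeQ_block -/A -/B; apply/eqP; rewrite -/(row_free _).
  apply: inj_row_free => r /eqP.
  rewrite !mul_mx_row !row_mx_eq0 => /andP[/andP[/eqP ri /eqP rj] /eqP rl].
  have full := fun i j : 'I_6 => blockQ_pair injA injB (ltn_ord i) (ltn_ord j).
  have [sij | dij] := eqVneq (i < 3)%N (j < 3)%N; first exact: full ri rj.
  have [sil | dil] := eqVneq (i < 3)%N (l < 3)%N; first exact: full ri rl.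
  apply: full rj rl => //.
  by move: dij dil; case: (i < 3)%N; case: (j < 3)%N; case: (l < 3)%N.
have [A' AK] := row_freeP (inj_row_free injA).
have [B' BK] := row_freeP (inj_row_free injB).
rewrite !nodeQ_block -/A -/B /helper_family inE.
have high (x : 'I_6) : (3 <= x)%N -> exists2 k, x = k.+3 :> nat & (k < 3)%N.
  by case: x => [[|[|[|k]]] //= ltk] _; exists k.
case: (ltnP f 3) => [ltf | /high[k -> _]]; rewrite !inE.
  case/high=> k1 def1 lt1 /high[k2 def2 lt2].
  rewrite -val_eqE /= def1 def2 !eqSS => neq12.
  exact: repair_family1 AK BK ltf lt1 lt2 neq12.
by move=> lt1 lt2 neq12; apply: repair_family2.
Qed.
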